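(* Let $(R,M)$ be a local domain, not a field. Then $R$ is $d$-super potent if and only if there is a divided prime $P\subsetneq M$ of $R$ such that $R/P$ is a valuation domain.
   Context: ``Local'' means having a unique maximal ideal (not necessarily Noetherian). A prime ideal $P$ of a domain $R$ is divided if $P=PR_P$. A nonzero finitely generated ideal $I$ of a domain $R$ is $d$-rigid if it is contained in exactly one maximal ideal of $R$, and $d$-super rigid if, in addition, every finitely generated ideal $J\supseteq I$ of $R$ is invertible. A domain $R$ is $d$-super potent if each maximal ideal of $R$ contains a $d$-super rigid ideal. *)

(* Defs.v *)
From mathcomp Require Import all_boot all_algebra.
From mathcomp Require Import boolp classical_sets.

Set Implicit Arguments.
Unset Strict Implicit.
Unset Printing Implicit Defensive.

Import GRing.Theory.

Local Open Scope classical_set_scope.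
Local Open Scope ring_scope.

(* Ideals are boolean predicates, as in ring_quotient.  Since boolp is
   available, every subset of R is of this form, so nothing is lost when
   quantifying over {pred R}.  The library's idealr_closed describes the
   proper ideals. *)

Section Ideals.
Variable R : comNzRingType.
Implicit Types I J M N : {pred R}.

Definition maximal_ideal M : Prop :=
  idealr_closed M /\
  forall N, idealr_closed N -> {subset M <= N} -> {subset N <= M}.

Definition local_with M : Prop :=
  maximal_ideal M /\ forall N, maximal_ideal N -> N =i M.

(* The unit ideal is allowed here. *)
Definition fg_ideal I : Prop :=
  exists (n : nat) (g : 'I_n -> R), forall x : R,
    x \in I <-> exists c : 'I_n -> R, x = \sum_(i < n) c i * g i.

Definition valuation_domain : Prop :=
  GRing.integral_domain_axiom R /\
  forall a b : R, (exists c, b = c * a) \/ (exists c, a = c * b).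

Definition d_rigid I : Prop :=
  [/\ fg_ideal I,
      exists2 x, x \in I & x != 0 &
      exists M, [/\ maximal_ideal M, {subset I <= M} &
        forall N, maximal_ideal N -> {subset I <= N} -> N =i M]].

End Ideals.

Arguments valuation_domain R : clear implicits.

Section Domains.
Variable R : idomainType.
Implicit Types I J P : {pred R}.

Local Notation K := {fraction R}.
Local Notation tofrac := (@FracField.tofrac R).

Definition frac_image I : set K := tofrac @` [set` I].

(* The set of finite sums of products a * b, i.e. the usual product of
   R-submodules of K. *)
Definition prod_submod (A B : set K) : set K :=
  [set x | exists (n : nat) (a b : 'I_n -> K),
     [/\ forall i, A (a i), forall i, B (b i) & x = \sum_(i < n) a i * b i]].

Definition localization_at P : set K :=
  [set x | exists a s : R, s \notin P /\ x = tofrac a / tofrac s].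

Definition divided P : Prop :=
  frac_image P = prod_submod (frac_image P) (localization_at P).

(* (R :_K J) *)
Definition inverse_ideal J : set K :=
  [set x | forall a, a \in J -> range tofrac (x * tofrac a)].

Definition invertible J : Prop :=
  prod_submod (frac_image J) (inverse_ideal J) = range tofrac.

Definition d_super_rigid I : Prop :=
  d_rigid I /\
  forall J, fg_ideal J -> {subset I <= J} -> invertible J.

Definition d_super_potent : Prop :=
  forall M : {pred R}, maximal_ideal M ->
    exists I : {pred R}, d_super_rigid I /\ {subset I <= M}.

End Domains.

Arguments d_super_potent R : clear implicits.

(* Main.v *)
Require Import Defs.
From HB Require Import structures.
From mathcomp Require Import all_boot all_algebra.
From mathcomp Require Import boolp classical_sets.
From mathcomp Require Import ring.

Set Implicit Arguments.
Unset Strict Implicit.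
Unset Printing Implicit Defensive.

Import GRing.Theory.
Local Open Scope ring_scope.

(** Call an element of [R] comparable if it divides, or is divided by, every
    element of [R].  For a prime [P], the two conditions on [P] taken together
    say exactly that every element outside [P] is comparable
    ([divided_valuationP]): modulo [P] comparability is the valuation
    condition, and [P = P R_P] says that every [s] outside [P] divides all of
    [P], which lifts divisibility from [R/P] to [R].

    If every element outside [P] is comparable and [x] lies in [M] but not in
    [P], a finitely generated ideal [J] containing [x] has a generator outside
    [P], and divisibility then singles out one such generator that divides all
    the others.  So [J] is principal and nonzero, hence invertible, and [(x)]
    is super rigid.

    Conversely, in a local ring an invertible finitely generated ideal is
    generated by one of its given generators ([invertible_local_generator]):
    a sum equal to [1] has a unit among its terms.  A super rigid ideal inside
    [M] is therefore [(x)] with [x] a nonzero nonunit, and for a divisor [a] of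
    [x] the ideal [(a, b)] contains [x], so [a] divides [b] or [b] divides [a]:
    every divisor of [x] is comparable.  Dividing out common factors [x], the
    same holds for every divisor of a power of [x].  The prime sought is
    the intersection of the ideals [(x^n)]: an element outside it is not
    divisible by some [x^n], hence divides that [x^n], hence is comparable. *)

Definition divides (R : pzRingType) (a b : R) : Prop := exists c, b = c * a.

(** * Maximal ideals and units *)

(** Zorn's lemma is applied to the sets [A] whose union with [I] is a proper
    ideal, rather than to the ideals above [I], so that the empty chain also
    has an upper bound. *)
Lemma proper_ideal_sub_maximal (R : comNzRingType) (I : {pred R}) :
  idealr_closed I -> exists2 M, maximal_ideal M & {subset I <= M}.
Proof.
move=> Iid; pose U (A : set R) : {pred R} := [pred x | `[< A x >] || (x \in I)].
have inU A x : x \in U A <-> A x \/ x \in I.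
  by rewrite inE; split=> [/orP[/asboolP|]|[/asboolP ->|->]];
    rewrite ?orbT //; [left|right].
have [F FP Ftot|A [UA Amax]] := @Zorn_bigcup R (fun A => idealr_closed (U A)).
  have [I0 I1 IM] := Iid; split.
  - by apply/inU; right.
  - apply/negP => /inU[[A FA A1]|]; last exact/negP.
    by have [_ /negP[]] := FP _ FA; apply/inU; left.
  move=> a u v /inU Uu /inU Uv; apply/inU.
  case: Uu Uv => [[A FA Au]|Iu] [[B FB Bv]|Iv].
  - have [C [FC Cu Cv]] : exists C, [/\ F C, C u & C v].
      by have [AB|BA] := Ftot _ _ FA FB; [exists B|exists A]; split=> //; auto.
    have [_ _ /(_ a u v)] := FP _ FC => /(_ _ _)/inU[|||]; last by right.
    + by apply/inU; left.
    + by apply/inU; left.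
    + by left; exists C.
  - have [_ _ /(_ a u v)] := FP _ FA => /(_ _ _)/inU[|||]; last by right.
    + by apply/inU; left.
    + by apply/inU; right.
    + by left; exists A.
  - have [_ _ /(_ a u v)] := FP _ FB => /(_ _ _)/inU[|||]; last by right.
    + by apply/inU; right.
    + by apply/inU; left.
    + by left; exists B.
  - by right; exact: IM.
exists (U A); last by move=> x Ix; apply/inU; right.
split=> // N Nid UN x Nx; apply: contrapT => /negP nUx.
have UNE : U [set` N]%classic =i N.
  move=> y; apply/idP/idP => [/inU[//|Iy]|Ny]; last by apply/inU; left.
  by apply: UN; apply/inU; right.
apply: (Amax [set` N]%classic).
  split=> [y Ay|/(_ x Nx) Ax]; first by apply: UN; apply/inU; left.
  by move/negP: nUx; apply; apply/inU; left.
have [N0 N1 NM] := Nid; split; rewrite ?UNE // => a u v.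
by rewrite !UNE; exact: NM.
Qed.

Section LocalRing.
Variables (R : comUnitRingType) (M : {pred R}).
Hypothesis R_local : local_with M.

Lemma notin_maximal_unit a : a \notin M -> a \is a GRing.unit.
Proof.
move=> aM; apply: contrapT => /negP aU.
pose I : {pred R} := [pred x : R | `[< divides a x >]].
have [|N Nmax IN] := @proper_ideal_sub_maximal _ I.
  split.
  - by apply/asboolP; exists 0; rewrite mul0r.
  - apply/negP => /asboolP[c ac]; move/negP: aU; apply.
    by apply/unitrP; exists c; rewrite (mulrC a) -ac.
  move=> b u v /asboolP[c ->] /asboolP[d ->]; apply/asboolP.
  by exists (b * c + d); rewrite mulrDl mulrA.
move/negP: aM; apply; rewrite -(R_local.2 N Nmax); apply: IN.
by apply/asboolP; exists 1; rewrite mul1r.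
Qed.

Lemma maximal_nounit a : a \in M -> a \isn't a GRing.unit.
Proof.
have [[[M0 M1 MM] _] _] := R_local; move=> aM; apply/negP => aU.
by move/negP: M1; apply; rewrite -(mulVr aU) -[_ * a]addr0 MM.
Qed.

Lemma sum_unit_local n (F : 'I_n -> R) :
  \sum_(i < n) F i \is a GRing.unit -> exists i, F i \is a GRing.unit.
Proof.
have [[[M0 _ MM] _] _] := R_local; move=> FU; apply: contrapT => nF.
suff /maximal_nounit : \sum_(i < n) F i \in M by rewrite FU.
elim/big_ind: _ => // [u v uM vM|i _]; first by rewrite -[u]mul1r MM.
apply: contrapT => /negP/notin_maximal_unit FiU; apply: nF.
by exists i.
Qed.

End LocalRing.

(** * Finitely generated ideals *)

Section FinitelyGenerated.
Variable R : idomainType.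
Implicit Types (a b x : R) (J : {pred R}).
Local Notation tofrac := (@FracField.tofrac R).

Definition span n (g : 'I_n -> R) : {pred R} :=
  [pred x | `[< exists c : 'I_n -> R, x = \sum_(i < n) c i * g i >]].

Lemma span_fg n (g : 'I_n -> R) : fg_ideal (span g).
Proof. by exists n, g => x; split=> /asboolP. Qed.

Lemma mem_gen n (g : 'I_n -> R) J i :
  (forall x, x \in J <-> exists c : 'I_n -> R, x = \sum_(i < n) c i * g i) ->
  g i \in J.
Proof.
move=> Jg; apply/Jg; exists (fun j => (j == i)%:R).
rewrite (bigD1 i) //= eqxx mul1r big1 ?addr0 // => j /negPf ->.
by rewrite mul0r.
Qed.

Lemma fg_ideal_mul J a x : fg_ideal J -> x \in J -> a * x \in J.
Proof.
move=> [n [g Jg]] /Jg[c ->]; apply/Jg; exists (fun i => a * c i).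
by rewrite mulr_sumr; apply: eq_bigr => i _; rewrite mulrA.
Qed.

Lemma divides_sum n (c g : 'I_n -> R) a :
  (forall i, divides a (g i)) -> divides a (\sum_(i < n) c i * g i).
Proof.
move=> ag; elim/big_ind: _ => [|u v [d ->] [e ->]|i _].
- by exists 0; rewrite mul0r.
- by exists (d + e); rewrite mulrDl.
- by have [d ->] := ag i; exists (c i * d); rewrite mulrA.
Qed.

Lemma principal_invertible J a :
  a != 0 -> (forall x, x \in J <-> divides a x) -> invertible J.
Proof.
move=> a0 Ja; have fa0 : tofrac a != 0 by rewrite tofrac_eq0.
apply/seteqP; split=> [_ [n [u [v [uJ vJ ->]]]]|_ [r _ <-]].
  elim/big_ind: _ => [|_ _ [r _ <-] [s _ <-]|i _].
  - by exists 0; rewrite // tofrac0.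
  - by exists (r + s); rewrite // tofracD.
  - by have [y yJ <-] := uJ i; rewrite mulrC; exact: vJ.
exists 1, (fun=> tofrac (r * a)), (fun=> (tofrac a)^-1); split=> [_|_|].
- by exists (r * a) => //; apply/Ja; exists r.
- move=> y /Ja[c ->]; exists c => //.
  by rewrite tofracM mulrC mulfK.
- by rewrite big_ord1 tofracM mulfK.
Qed.

(** Writing [1] as a sum of products of elements of [J] and of its inverse,
    some product [u v] is a unit.  Expanding [u] in the generators, some
    [g_j v] is a unit too; then [y = (y v) (g_j v)^-1 g_j] for every [y] in
    [J], with [y v] in [R]. *)
Lemma invertible_local_generator (M : {pred R}) n (g : 'I_n -> R) J :
    local_with M ->
    (forall x, x \in J <-> exists c : 'I_n -> R, x = \sum_(i < n) c i * g i) ->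
    invertible J ->
  exists i, forall x, x \in J -> divides (g i) x.
Proof.
move=> Rloc Jg Jinv.
have : range tofrac 1 by exists 1 => //; exact: tofrac1.
rewrite -Jinv => -[m [u [v [uJ vJ uv1]]]].
have /choice[w Ew] i : exists w, w \in J /\ tofrac w = u i.
  by have [w wJ Ew] := uJ i; exists w.
have w_J i : w i \in J by have [] := Ew i.
have [k Hk] : exists k, exists2 r, r \is a GRing.unit & tofrac r = u k * v k.
  have /choice[r Er] i : exists r, tofrac r = u i * v i.
    have [r _ Er] := vJ i _ (w_J i); exists r.
    by rewrite Er mulrC; have [_ ->] := Ew i.
  have [|k rU] := sum_unit_local Rloc (F := r); last by exists k, (r k).
  suff -> : \sum_(i < m) r i = 1 by exact: unitr1.
  apply/eqP; rewrite -tofrac_eq tofrac1 uv1 rmorph_sum /=.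
  by apply/eqP; apply: eq_bigr.
have [r rU Er] := Hk.
have /choice[h Eh] j : exists h, tofrac h = v k * tofrac (g j).
  by have [h _ <-] := vJ k _ (mem_gen j Jg); exists h.
have /Jg[c wc] := w_J k.
have [|j chU] := sum_unit_local Rloc (F := fun j => c j * h j).
  suff -> : \sum_(j < n) c j * h j = r by [].
  apply/eqP; rewrite -tofrac_eq Er; have [_ <-] := Ew k.
  rewrite wc !rmorph_sum /= mulr_suml; apply/eqP; apply: eq_bigr => j _.
  by rewrite !tofracM Eh; ring.
have hU : h j \is a GRing.unit by move: chU; rewrite unitrM => /andP[].
exists j => x /(vJ k)[t _ Et]; exists (t * (h j)^-1).
apply: (mulIr hU); rewrite mulrAC divrK //; apply/eqP; rewrite -tofrac_eq.
by rewrite !tofracM Eh Et; apply/eqP; ring.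
Qed.

End FinitelyGenerated.

(** * Comparable elements *)

Section Comparable.
Variable R : idomainType.
Implicit Types a b s x : R.
Local Notation tofrac := (@FracField.tofrac R).

Definition comparable_elt a : Prop := forall b, divides a b \/ divides b a.

Lemma dividedP (P : prime_idealr R) :
  divided P <->
  forall p s, p \in P -> s \notin P -> exists2 q, q \in P & p = q * s.
Proof.
split=> [Pdiv p s pP sP|Pdiv].
  have s0 : tofrac s != 0.
    by rewrite tofrac_eq0; apply: contraNneq sP => ->; exact: idealr0.
  have : frac_image P (tofrac p / tofrac s).
    rewrite Pdiv; exists 1, (fun=> tofrac p), (fun=> tofrac 1 / tofrac s).
    split=> [_|_|]; first by exists p.
    - by exists 1, s.
    - by rewrite big_ord1 tofrac1 mul1r.
  move=> [q qP qE]; exists q => //; apply/eqP.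
  by rewrite -tofrac_eq tofracM qE divfK.
apply/seteqP; split=> [_ [p pP <-]|_ [n [u [v [uP vP ->]]]]].
  exists 1, (fun=> tofrac p), (fun=> 1); split=> [_|_|]; first by exists p.
  - by exists 1, 1; rewrite idealr1 tofrac1 divr1.
  - by rewrite big_ord1 mulr1.
elim/big_ind: _ => [|_ _ [p pP <-] [q qP <-]|i _].
- by exists 0; [exact: idealr0|exact: tofrac0].
- by exists (p + q); [exact: rpredD|exact: tofracD].
have [p pP <-] := uP i; have [a [s [sP ->]]] := vP i.
have s0 : tofrac s != 0.
  by rewrite tofrac_eq0; apply: contraNneq sP => ->; exact: idealr0.
have [q qP ->] := Pdiv p s pP sP; exists (a * q); first exact: idealMr.
by rewrite !tofracM mulrA [_ * tofrac s * _]mulrAC mulfK // mulrC.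
Qed.


Lemma quot_valuationP (P : prime_idealr R) :
  valuation_domain {ideal_quot P} <->
  forall a b, (exists c, b - c * a \in P) \/ (exists c, a - c * b \in P).
Proof.
pose pi := \pi_({ideal_quot P})%qT : R -> {ideal_quot P}.
have piM c a b : b - c * a \in P <-> pi b = (pi c * pi a)%R.
  by rewrite -rmorphM Quotient.idealrBE; split=> /eqP.
have pi_onto (y : {ideal_quot P}) : exists c, y = pi c.
  by exists (repr y); rewrite /pi reprK.
split=> [[_ Pval] a b|Pval].
  by have [] := Pval (pi a) (pi b) => -[y]; have [c ->] := pi_onto y;
    move=> /piM ?; [left|right]; exists c.
split=> [y z|y z]; first exact: Quotient.rquot_IdomainAxiom.
have [a ->] := pi_onto y; have [b ->] := pi_onto z.
by have [[c /piM]|[c /piM]] := Pval a b; [left|right]; exists (pi c).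
Qed.

(** Both conditions together lift divisibility modulo [P] to divisibility in
    [R]: if [a] is outside [P] and divides [b] modulo [P], the error term lies
    in [P], hence is itself a multiple of [a]. *)
Lemma divided_valuationP (P : prime_idealr R) :
  divided P /\ valuation_domain {ideal_quot P} <->
  forall a, a \notin P -> comparable_elt a.
Proof.
rewrite dividedP quot_valuationP; split=> [[Pdiv Pval] a aP b|Pcomp].
  have lift s y c : s \notin P -> y - c * s \in P -> divides s y.
    move=> sP /Pdiv/(_ sP)[q _ /eqP]; rewrite subr_eq => /eqP ->.
    by exists (q + c); rewrite mulrDl.
  have [[c bca]|[c acb]] := Pval a b; first by left; exact: lift bca.
  have bP : b \notin P.
    apply: contra aP => bP; rewrite -(subrK (c * b) a).
    by rewrite rpredD // idealMr.
  by right; exact: lift acb.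
split=> [p s pP sP|a b].
  have [[q pE]|[c sE]] := Pcomp s sP p; last first.
    by move: sP; rewrite sE idealMr.
  by exists q => //; move: pP; rewrite pE prime_idealrM (negPf sP) orbF.
have [aP|aP] := boolP (a \in P).
  by right; exists 0; rewrite mul0r subr0.
by have [[c ->]|[c ->]] := Pcomp a aP b; [left|right]; exists c;
  rewrite subrr idealr0.
Qed.

(** Only elements outside [P] need be comparable, so the search for a common
    divisor must avoid [P]: it starts outside [P] and stays there, because each
    new candidate divides the previous one and [P] is closed under multiples. *)
Lemma common_divisor_notin (P : prime_idealr R) a0 (s : seq R) :
    (forall a, a \notin P -> comparable_elt a) -> a0 \notin P ->
  exists a, [/\ a \in a0 :: s, a \notin P &
                forall b, b \in a0 :: s -> divides a b].
Proof.
move=> Pcomp a0P; elim: s => [|b s [a [as_ aP adiv]]].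
  exists a0; split=> // [|b]; rewrite inE // => /eqP ->.
  by exists 1; rewrite mul1r.
have [ab|[c aE]] := Pcomp a aP b.
  exists a; split=> // [|d].
    by move: as_; rewrite !inE => /orP[->|->]; rewrite ?orbT.
  rewrite !inE => /or3P[/eqP ->|/eqP ->//|ds].
    by apply: adiv; rewrite mem_head.
  by apply: adiv; rewrite inE ds orbT.
have b_div d : d \in a0 :: s -> divides b d.
  by move=> /adiv[e ->]; exists (e * c); rewrite aE mulrA.
exists b; split=> [||d]; first by rewrite !inE eqxx orbT.
  by apply: contra aP; rewrite aE; exact: idealMr.
rewrite !inE => /or3P[/eqP ->|/eqP ->|ds].
- by apply: b_div; rewrite mem_head.
- by exists 1; rewrite mul1r.
- by apply: b_div; rewrite inE ds orbT.
Qed.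

Lemma fg_ideal_principal (P : prime_idealr R) (J : {pred R}) x :
    (forall a, a \notin P -> comparable_elt a) ->
    fg_ideal J -> x \in J -> x \notin P ->
  exists2 a, a != 0 & forall y, y \in J <-> divides a y.
Proof.
move=> Pcomp Jfg xJ xP; have [n [g Jg]] := Jfg.
have [i giP] : exists i, g i \notin P.
  apply: contrapT => /forallNP gP; move/negP: xP; apply.
  have /Jg[c ->] := xJ; apply: rpred_sum => i _; rewrite idealMr //.
  by apply: contrapT => /negP; exact: gP.
have [a [ag aP adiv]] := common_divisor_notin (codom g) Pcomp giP.
have aJ : a \in J.
  by move: ag; rewrite inE => /predU1P[->|/codomP[j ->]]; exact: mem_gen Jg.
exists a => [|y]; first by apply: contraNneq aP => ->; exact: idealr0.
split=> [/Jg[c ->]|[c ->]]; last exact: fg_ideal_mul.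
by apply: divides_sum => j; apply: adiv; rewrite inE codom_f orbT.
Qed.

Lemma d_super_rigid_principal (M : {pred R}) (P : prime_idealr R) x :
    local_with M -> (forall a, a \notin P -> comparable_elt a) ->
    x \in M -> x \notin P ->
  d_super_rigid (span (fun _ : 'I_1 => x)) /\
  {subset span (fun _ : 'I_1 => x) <= M}.
Proof.
move=> [Mmax Muniq] Pcomp xM xP.
have xI : x \in span (fun _ : 'I_1 => x).
  by apply/asboolP; exists (fun=> 1); rewrite big_ord1 mul1r.
have IM : {subset span (fun _ : 'I_1 => x) <= M}.
  have [[M0 _ MM] _] := Mmax.
  move=> _ /asboolP[c ->]; rewrite big_ord1 -[_ * _]addr0.
  exact: MM.
split=> //; split=> [|J Jfg IJ].
  split; first exact: span_fg.
    by exists x => //; apply: contraNneq xP => ->; exact: idealr0.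
  by exists M; split=> // N Nmax _; exact: Muniq.
have [a a0 Ja] := fg_ideal_principal Pcomp Jfg (IJ _ xI) xP.
exact: principal_invertible Ja.
Qed.

(** * The intersection of the powers of a nonunit *)

(** If [x] divides both [a] and [b], it can be cancelled from both, and the
    quotient of [a] divides a lower power of [x].  Otherwise, [x] being itself
    comparable, either [a] divides [x], or [x] divides [a] and [b] divides [x],
    hence [a]. *)
Lemma pow_divisor_comparable x n a :
    x != 0 -> (forall c, divides c x -> comparable_elt c) ->
  divides a (x ^+ n) -> comparable_elt a.
Proof.
move=> x0 xcomp; elim: n a => [|n IH] a.
  by move=> [c ac] b; left; exists (b * c); rewrite -mulrA -ac expr0 mulr1.
have xc : comparable_elt x by apply: xcomp; exists 1; rewrite mul1r.
move=> axn; have [[c aE]|/xcomp//] := xc a; move=> b.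
have [[d bE]|[d xE]] := xc b; last first.
  by right; exists (c * d); rewrite aE xE mulrA.
have {axn} cxn : divides c (x ^+ n).
  have [e eE] := axn; exists e; apply: (mulIf x0).
  by rewrite -exprSr eE aE mulrA.
by have [[e E]|[e E]] := IH c cxn d; [left|right]; exists e;
  rewrite aE bE E mulrA.
Qed.

Definition powers_inter x : {pred R} :=
  [pred a | `[< forall n, divides (x ^+ n) a >]].

Section PowersIntersection.
Variable x : R.
Hypotheses (x0 : x != 0) (xU : x \isn't a GRing.unit).
Hypothesis xcomp : forall c, divides c x -> comparable_elt c.

Lemma notin_powers_inter a :
  a \notin powers_inter x -> exists n, divides a (x ^+ n).
Proof.
move=> /asboolPn/existsNP[n nxa]; exists n.
have xx : divides (x ^+ n) (x ^+ n) by exists 1; rewrite mul1r.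
by have [] := pow_divisor_comparable x0 xcomp xx a.
Qed.

Lemma comparable_notin_powers_inter a :
  a \notin powers_inter x -> comparable_elt a.
Proof.
by move=> /notin_powers_inter[n an]; exact: pow_divisor_comparable an.
Qed.

Lemma pow_ndivides_pred n : ~ divides (x ^+ n.+1) (x ^+ n).
Proof.
move=> [c E]; move/negP: xU; apply; apply/unitrP; exists c.
suff E1 : c * x = 1 by rewrite (mulrC x) E1.
by apply: (mulIf (expf_neq0 n x0)); rewrite mul1r -mulrA -exprS.
Qed.

Lemma powers_inter_idealr : idealr_closed (powers_inter x).
Proof.
split.
- by apply/asboolP => n; exists 0; rewrite mul0r.
- by apply/asboolPn => /(_ 1); exact: (@pow_ndivides_pred 0).
move=> a u v /asboolP xu /asboolP xv; apply/asboolP => n.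
have [c ->] := xu n; have [d ->] := xv n.
by exists (a * c + d); rewrite mulrDl mulrA.
Qed.

Lemma powers_inter_prime : prime_idealr_closed (powers_inter x).
Proof.
move=> u v /asboolP uv; apply: contrapT => /negP; rewrite negb_or => /andP[].
move=> /notin_powers_inter[n [c cE]] /notin_powers_inter[m [d dE]].
apply: (@pow_ndivides_pred (n + m)); have [e eE] := uv (n + m).+1.
by exists (c * d * e); rewrite exprD cE dE -mulrA -eE mulrACA.
Qed.

HB.instance Definition _ := isIdealr.Build R (powers_inter x)
  powers_inter_idealr.
HB.instance Definition _ := isPrimeIdealrClosed.Build R (powers_inter x)
  powers_inter_prime.

Definition powers_inter_prime_idealr : prime_idealr R := powers_inter x.

End PowersIntersection.

(** The ideal [I] is spanned by one of its generators [x], so the finitely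
    generated ideals above [I] are those containing [x]; for [c] dividing [x],
    [(c, b)] is one of them. *)
Lemma super_rigid_generator (M I : {pred R}) :
    local_with M -> d_super_rigid I -> {subset I <= M} ->
  exists x, [/\ x \in M, x != 0 & forall c, divides c x -> comparable_elt c].
Proof.
move=> Rloc [[Ifg [z zI z0] _] Iinv] IM; have [n [g Ig]] := Ifg.
have [i gi_dvd] := invertible_local_generator Rloc Ig (Iinv I Ifg (fun=> id)).
have giI : g i \in I by exact: mem_gen Ig.
exists (g i); split; first exact: IM.
  by apply: contraNneq z0 => gi0; have [c ->] := gi_dvd z zI; rewrite gi0 mulr0.
move=> c [d gE] b; pose h (j : 'I_2) := if j == ord0 then c else b.
have hJ : forall y, y \in span h <-> exists e : 'I_2 -> R, y = \sum_j e j * h j.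
  by move=> y; split=> /asboolP.
have IJ : {subset I <= span h}.
  move=> y /gi_dvd[e ->]; apply: fg_ideal_mul; first exact: span_fg.
  by rewrite gE; apply: fg_ideal_mul; [exact: span_fg|exact: (mem_gen ord0 hJ)].
have [j jdvd] := invertible_local_generator Rloc hJ (Iinv _ (span_fg h) IJ).
have jc : divides (h j) c := jdvd _ (mem_gen ord0 hJ).
have jb : divides (h j) b := jdvd _ (mem_gen ord_max hJ).
have [hj|hj] : h j = c \/ h j = b.
  by rewrite /h; case: ifP => _; [left|right].
- by left; rewrite -hj.
- by right; rewrite -hj.
Qed.

End Comparable.

Theorem theorem2p2 (R : idomainType) (M : {pred R})
    (R_local : local_with M) (R_not_field : ~ GRing.field_axiom R) :
  d_super_potent R <->
  exists P : prime_idealr R,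
    [/\ divided P,
        {subset P <= M},
        exists2 x, x \in M & x \notin P &
        valuation_domain {ideal_quot P}].
Proof.
split=> [Rpot|[P [Pdiv PM [x xM xP] Pval]] N Nmax].
  have [I [Isr IM]] := Rpot M R_local.1.
  have [x [xM x0 xcomp]] := super_rigid_generator R_local Isr IM.
  have xU := maximal_nounit R_local xM.
  pose P := powers_inter_prime_idealr x0 xU xcomp.
  have [Pdiv Pval] : divided P /\ valuation_domain {ideal_quot P}.
    by apply/divided_valuationP; exact: comparable_notin_powers_inter.
  exists P; split=> //.
    move=> a /asboolP/(_ 1)[c ->]; rewrite expr1 -[_ * _]addr0.
    by have [[[M0 _ MM] _] _] := R_local; exact: MM.
  exists x => //; apply/asboolPn => /(_ 2).
  by rewrite -{2}(expr1 x); exact: pow_ndivides_pred.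
have Pcomp := (divided_valuationP P).1 (conj Pdiv Pval).
have [Isr IM] := d_super_rigid_principal R_local Pcomp xM xP.
exists (span (fun _ : 'I_1 => x)); split; first exact: Isr.
by move=> a /IM aM; rewrite (R_local.2 N Nmax).
Qed.
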